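(* Let $G=(V,E)$ be a locally finite, connected graph with graph metric $d$ and let $\rho\colon[0,\infty]\to[0,\infty]$ be a function with $\{\rho=0\}=\{0\}$. Then the following are equivalent: (i) There exist a measure space $(Y,\nu)$, a Lipschitz function $f\colon V\to L^1(Y,\nu)$ and a constant $c>0$ such that $\|f(u)-f(v)\|\ge c\,\rho(d(u,v))$ for every $u,v\in V$. (ii) There exists $C>0$ such that for every $p<1$ there exists a general bond percolation $\mathbf{P}$ on $G$, with configuration denoted $\omega$, such that $\mathbf{P}[e\in\omega]>p$ for every $e\in E$ and such that, for some $\beta,\gamma>0$ with $\beta/\gamma\le C$, $$e^{-\beta d(u,v)}\ \le\ \mathbf{P}[u\leftrightarrow v]\ \le\ e^{-\gamma\rho(d(u,v))}\qquad\text{for every }u,v\in V .$$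
   Context: Graphs have a vertex set $V$ and a set $E$ of undirected edges. A graph is locally finite if every vertex has finite degree. For a connected graph, $d(u,v)$ is the length of a shortest path joining $u$ and $v$; Lipschitz means Lipschitz with respect to $d$ and the $L^1$-norm. A general bond percolation on $G$ is a probability measure $\mathbf{P}$ on subsets of $E$, i.e. on $\{0,1\}^E$ with its Borel $\sigma$-algebra (no invariance or independence is assumed). The configuration $\omega\subset E$ is identified with the induced subgraph with vertex set $V$ and edge set $\omega$; its connected components are called clusters, and $\{u\leftrightarrow v\}$ is the event that $u$ and $v$ lie in the same cluster of $\omega$. The convention $e^{-\infty}=0$ is used. *)

(* Defs.v *)
From HB Require Import structures.
From mathcomp Require Export all_boot all_order all_algebra.
From mathcomp Require Export all_classical all_reals all_analysis.

Set Implicit Arguments.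
Unset Strict Implicit.
Unset Printing Implicit Defensive.
Import Order.TTheory GRing.Theory Num.Theory.

Local Open Scope classical_set_scope.
Local Open Scope ring_scope.

(* Loops and multiple edges are allowed; a simple graph is the case where
   [ends] is injective and has no singleton value. *)
Record graph := Graph {
  vertex : choiceType;
  edge : choiceType;
  ends : edge -> set vertex;
  ends_pair : forall e, exists u v, ends e = [set u; v]
}.

Section Graph.
Variable G : graph.
Implicit Types (F : set (edge G)) (u v : vertex G).

Definition locally_finite := forall v, finite_set [set e : edge G | ends e v].

Definition adj F : rel (vertex G) :=
  fun u v => `[< exists2 e, F e & ends e = [set u; v] >].

(* Vertices may be repeated; a walk of minimal length is a path. *)
Definition walk F u v (n : nat) :=
  exists s : seq (vertex G), [/\ path (adj F) u s, last u s = v & size s = n].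

Definition same_component F u v := exists n, walk F u v n.

Definition connected_graph := forall u v, same_component setT u v.

(* The default value 0 is only used when no walk joins [u] and [v]. *)
Definition gdist u v : nat :=
  xget 0%N [set n | walk setT u v n /\
                    forall m, walk setT u v m -> (n <= m)%N].

Definition config_space := prod_topology (fun _ : edge G => bool).

HB.instance Definition _ := Topological.on config_space.
HB.instance Definition _ := Pointed.on config_space.

Definition config : measurableType (@open config_space).-sigma :=
  g_sigma_algebraType (@open config_space).

Definition open_edges (w : config) : set (edge G) := [set e | w e].

Definition edge_open (e : edge G) : set config := [set w | open_edges w e].

Definition same_cluster u v : set config :=
  [set w | same_component (open_edges w) u v].

Definition percolation (R : realType) := probability config R.

End Graph.

(* An element of [LspaceType1 nu] is a class of a.e. equal functions; it coerces
   to one of its representatives, on which the value below does not depend. *)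
Definition L1dist (R : realType) d (Y : measurableType d)
    (nu : {measure set Y -> \bar R}) (g h : LspaceType1 nu) : \bar R :=
  'N[nu]_1[EFin \o ((g : Y -> R) \- (h : Y -> R))].

Definition L1_lower_bound (R : realType) (G : graph) (rho : \bar R -> \bar R) :=
  exists (d : measure_display) (Y : measurableType d)
         (nu : {measure set Y -> \bar R})
         (f : vertex G -> LspaceType1 nu) (c : R),
    [/\ exists K : R, forall u v : vertex G,
          (L1dist (f u) (f v) <= (K * (gdist u v)%:R)%:E)%E,
        0 < c &
        forall u v : vertex G,
          (c%:E * rho (gdist u v)%:R%:E <=
             L1dist (f u) (f v))%E].

Definition percolation_bounds (R : realType) (G : graph)
    (rho : \bar R -> \bar R) :=
  exists2 C : R, 0 < C & forall p : R, p < 1 ->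
    exists P : percolation G R,
      (forall e : edge G, (p%:E < P (edge_open e))%E) /\
      exists beta gamma : R, [/\ 0 < beta, 0 < gamma, beta / gamma <= C &
        forall u v : vertex G,
          (expeR (- (beta * (gdist u v)%:R)%:E) <= P (same_cluster u v) /\
           P (same_cluster u v) <= expeR (- (gamma%:E * rho (gdist u v)%:R%:E)))%E].

(* Main.v *)
From HB Require Import structures.
From mathcomp Require Import ring lra.
From mathcomp Require Import measurable_realfun.
Require Import Defs.

(** From an L^1 map to percolations. A map f into L^1(Y, nu) turns every point
    (y, t) of Y x R into a wall, which separates the vertices u with t < f u y
    from the others; the nu x Lebesgue mass of the walls between u and v is
    the L^1 distance of f u and f v (wall_measureE). If walls fall according
    to a Poisson process of intensity lam, and an edge is kept when no wall
    separates its ends, then u and v stay connected only if no wall separates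
    them, which has probability exp (- lam |f u - f v|), and they are
    connected as soon as no wall cuts a geodesic, which has probability at
    least exp (- lam K d(u,v)). So beta / gamma is bounded independently of
    lam, while small values of lam make all edges likely. The total mass of
    the walls being infinite in general, the process is built as a limit: one
    random wall of small intensity among finitely many vertices gives a
    percolation (one_wall), the intersection of N independent copies raises
    probabilities to the power N (percolation_power), and a weak limit is
    taken along the stages (wall_percolation_exists). The stages satisfy only
    exp (-2x) <= (1 - x/N)^N <= exp (-x); the factor 2 goes into C.

    From percolations to an L^1 map. For a partition into clusters, the number
    of clusters that contain exactly one of u and v is 2 if u and v are
    separated and 0 otherwise; omitting the cluster of a root leaves 1 or 2.
    Hence P[u not connected to v] is, up to a factor 2, the measure of the
    cuts between u and v for the law of the clusters. For percolations P_n
    with p tending to 1, gamma_n rho(d(u,v)) tends to 0 and P_n[u not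
    connected to v] / gamma_n lies between (1 - exp (- gamma_n rho)) /
    gamma_n, which is eventually at least rho / 2, and beta_n d / gamma_n <= C
    d. The rescaled laws of the clusters avoiding the root therefore have a
    limit, a measure nu on the subsets of V (cluster_limit), and v is sent to
    the indicator of the subsets that contain v.

    Both limits come from one compactness principle (config_measure_compact):
    along an ultrafilter, measures of bounded mass on {0,1}^E converge on
    every clopen set, the limit is finitely additive there, and compactness of
    {0,1}^E makes it extend to a measure. Connection events are open, so they
    pass to the limit by open_limit_le from above, and through single paths,
    which are clopen events, from below. *)

Import Order.TTheory GRing.Theory Num.Theory.
Import numFieldNormedType.Exports.
Set Implicit Arguments.
Unset Strict Implicit.
Unset Printing Implicit Defensive.
Local Open Scope classical_set_scope.
Local Open Scope ring_scope.

(** * Bounds on the exponential *)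

Section real_bounds.
Variable R : realType.
Implicit Types x : R.

Lemma expRN_le x : 0 <= x -> expR (- x) <= (1 + x)^-1.
Proof.
move=> x0; rewrite expRN lef_pV2 ?posrE ?expR_gt0 ?expR_ge1Dx//.
by rewrite ltr_wpDr.
Qed.

Lemma expRN_le_half x : 0 <= x -> x <= 1 -> expR (- x) <= 1 - x / 2.
Proof.
move=> x0 x1; apply: le_trans (expRN_le x0) _.
rewrite -[leLHS]mul1r ler_pdivrMr; last by lra.
by nra.
Qed.

(** Used to see that gamma rho <= 1 once clusters are connected with
    probability at least 1/2: indeed exp (-1) <= 1/2. *)
Lemma expRN_dichotomy x : 1 / 2 <= expR (- x) -> x <= 1.
Proof.
move=> hx; rewrite leNgt; apply/negP => x1.
have : expR (- x) < expR (- 1) by rewrite ltr_expR ltrN2.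
have : expR (- 1) <= 1 / 2 :> R by rewrite mul1r; exact: expRN_le.
by lra.
Qed.

Lemma expRN2_le x : 0 <= x -> x <= 1 / 2 -> expR (- (2 * x)) <= 1 - x.
Proof.
move=> x0 x1; apply: le_trans (expRN_le (x := 2 * x) _) _; first by lra.
rewrite -[leLHS]mul1r ler_pdivrMr; last by lra.
by nra.
Qed.

Lemma exp_le_pow x (N : nat) : 0 <= x -> (0 < N)%N -> 2 * x <= N%:R ->
  expR (- (2 * x)) <= (1 - x / N%:R) ^+ N.
Proof.
move=> x0 N0 xN; have N0' : 0 < N%:R :> R by rewrite ltr0n.
have -> : - (2 * x) = N%:R * (- (2 * (x / N%:R))).
  by field; rewrite gt_eqF.
rewrite expRM_natl lerXn2r ?nnegrE ?expR_ge0//.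
  by rewrite subr_ge0 ler_pdivrMr// mul1r; lra.
apply: expRN2_le; first by rewrite divr_ge0// ltW.
by rewrite ler_pdivrMr//; lra.
Qed.

Lemma pow_le_exp x (N : nat) : (0 < N)%N -> 0 <= 1 - x / N%:R ->
  (1 - x / N%:R) ^+ N <= expR (- x).
Proof.
move=> N0 xN; have N0' : 0 < N%:R :> R by rewrite ltr0n.
have -> : - x = N%:R * (- (x / N%:R)) by field; rewrite gt_eqF.
by rewrite expRM_natl lerXn2r ?nnegrE ?expR_ge0// expR_ge1Dx.
Qed.

End real_bounds.

(** * The topology of configuration spaces *)

Section config.
Variable G : graph.

Lemma config_compact : compact [set: config_space G].
Proof.
have := @tychonoff (edge G) (fun=> bool) _ (fun=> bool_compact).
by congr (compact _); rewrite eqEsubset.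
Qed.

Definition cylinder (s : seq (edge G * bool)) : set (config_space G) :=
  [set w | forall p, p \in s -> w p.1 = p.2].

Lemma coord_clopen e b : clopen [set w : config_space G | w e = b].
Proof.
apply: (@preimage_clopen (config_space G) bool (fun w => w e) [set b]).
  by split; [exact: discrete_open|exact: discrete_closed].
exact: (@proj_continuous _ (fun=> bool)).
Qed.

Lemma cylinder_cons p s :
  cylinder (p :: s) = [set w | w p.1 = p.2] `&` cylinder s.
Proof.
apply/seteqP; split => [w ws|w [wp ws] q].
  split; first by apply: ws; rewrite mem_head.
  by move=> q qs; apply: ws; rewrite in_cons qs orbT.
by rewrite in_cons => /orP[/eqP ->//|/ws].
Qed.

Lemma cylinder_clopen s : clopen (cylinder s).
Proof.
elim: s => [|p s IH].
  by rewrite (_ : cylinder [::] = setT); [exact: clopenT|exact/seteqP].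
by rewrite cylinder_cons; apply: clopenI => //; exact: coord_clopen.
Qed.

(** The cylinders around w generate a filter that converges to w
    coordinatewise, hence for the product topology. *)
Lemma cylinder_nbhs (A : set (config_space G)) (w : config_space G) :
  open A -> A w -> exists2 s, cylinder s w & cylinder s `<=` A.
Proof.
move=> oA Aw.
pose F := filter_from [set s | cylinder s w] cylinder.
have FF : Filter F.
  apply: filter_from_filter; first by exists [::].
  move=> s t ws wt; exists (s ++ t) => [p|x xst]; rewrite /=.
    by rewrite mem_cat => /orP[/ws|/wt].
  by split=> p ps; apply: xst; rewrite mem_cat ps ?orbT.
suff : F --> w by move=> /(_ A (open_nbhs_nbhs (conj oA Aw))) [s]; exists s.
apply/cvg_sup => e B [C [[D oD <-]] /= De] DB.
exists [:: (e, w e)] => [p|x xe]; first by rewrite inE => /eqP ->.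
by apply: DB => /=; rewrite (xe (e, w e)) ?mem_head.
Qed.

Hypothesis countable_edges : countable [set: edge G].

(** Cylinders are coded by finite sequences, so a countable set of edges has
    countably many of them; an integer that codes no cylinder inside A
    contributes the empty set. *)
Lemma open_cylinders (A : set (config_space G)) : open A ->
  exists F : nat -> set (config_space G),
   (forall n, F n = set0 \/ exists s, F n = cylinder s) /\ A = \bigcup_n F n.
Proof.
move=> oA.
have [f /= fI] : exists f : edge G -> nat, injective f.
  have /pcard_leP/unsquash f := countable_edges.
  by exists f => x y xy; apply: (@inj _ _ _ f); rewrite ?inE.
(* An injective code of cylinders by integers. *)
pose code (s : seq (edge G * bool)) := pickle [seq (f p.1, p.2) | p <- s].
have codeI : injective code.
  move=> s t /(pcan_inj pickleK) /inj_map; apply.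
  by move=> [a b] [c d] [/= /fI -> ->].
pose F n :=
  [set w | exists s, [/\ code s = n, cylinder s w & cylinder s `<=` A]].
exists F; split.
  move=> n.
  have [[s [sn sA]]|h] := pselect (exists s, code s = n /\ cylinder s `<=` A).
    right; exists s; apply/seteqP; split=> [w [t [tn wt _]]|w ws].
      by have -> : s = t by apply: codeI; rewrite sn tn.
    by exists s.
  left; rewrite -subset0 => w [s [sn sw sA]]; apply: h; by exists s.
apply/seteqP; split=> [w Aw|w [n _ [s [_ ws]]]]; last exact.
have [s sw sA] := cylinder_nbhs oA Aw.
by exists (code s) => //; exists s.
Qed.

Lemma open_measurable_config (A : set (config G)) :
  open (A : set (config_space G)) -> measurable A.
Proof. exact: sub_sigma_algebra. Qed.

Lemma clopen_measurable (A : set (config G)) :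
  clopen (A : set (config_space G)) -> measurable A.
Proof. by move=> [oA _]; exact: open_measurable_config. Qed.

Lemma measurable_config_fun d (T : measurableType d) (h : T -> config G) :
  (forall e, measurable [set x | h x e]) -> measurable_fun setT h.
Proof.
move=> mh.
have mcyl s : measurable (h @^-1` cylinder s).
  elim: s => [|[e b] s IH].
    by rewrite (_ : _ @^-1` _ = setT)//; exact/seteqP.
  rewrite cylinder_cons preimage_setI; apply: measurableI => //.
  case: b; first exact: mh.
  rewrite (_ : _ @^-1` _ = ~` [set x | h x e]); first exact: measurableC.
  by apply/seteqP; split=> x /=; [move=> ->|move/negP/negbTE].
apply: (@measurability _ _ _ _ setT h (@open (config_space G))) => //.
move=> _ [A oA <-]; rewrite setTI.
have [F [FE ->]] := open_cylinders oA.
rewrite preimage_bigcup; apply: bigcupT_measurable => n.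
by have [->|[s ->]] := FE n; rewrite ?preimage_set0.
Qed.
End config.

(** * Extending finitely additive functions of clopen sets *)

(** The image measure, as an existence statement that hides the
    measurability proof from the type of the measure. *)
Lemma pushforward_exists d d' (T : measurableType d) (T' : measurableType d')
    (R : realType) (m : {measure set T -> \bar R}) (h : T -> T') :
  measurable_fun setT h ->
  exists m' : {measure set T' -> \bar R}, forall A, m' A = m (h @^-1` A).
Proof.
move=> mh.
by unshelve eexists (pushforward m h : {measure set T' -> \bar R}).
Qed.

(** A copy of the configuration space whose measurable sets are the clopen
    ones, as required by the measure extension theorem. *)
Definition clopen_algebra (G : graph) : Type := config_space G.
HB.instance Definition _ G := Pointed.on (clopen_algebra G).

Definition clopen_display : measure_display -> measure_display.
Proof. by []. Qed.

HB.instance Definition _ G :=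
  @isAlgebraOfSets.Build (clopen_display default_measure_display)
    (clopen_algebra G) (@clopen (config_space G))
    clopen0 (@clopenU (config_space G))
    (fun A => @clopenC (config_space G) A A).

Section extension.
Variables (R : realType) (G : graph) (L : set (config G) -> \bar R).
Hypothesis countable_edges : countable [set: edge G].
Hypothesis L_ge0 : forall A, (0 <= L A)%E.
Hypothesis L0 : L set0 = 0%E.
Hypothesis L_add : forall A B : set (config_space G), clopen A -> clopen B ->
  A `&` B = set0 -> L (A `|` B) = (L A + L B)%E.

(** A clopen set covered by countably many clopen sets is covered by finitely
    many of them, so finite additivity already gives countable subadditivity and
    Caratheodory's theorem applies.  Open sets being countable unions of
    cylinders, the clopen sets generate the Borel sigma-algebra. *)
Lemma clopen_content_extends :
  exists mu : {measure set (config G) -> \bar R},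
    forall A : set (config_space G), clopen A -> mu A = L A.
Proof.
have Ladd :
    measure_function.semi_additive (L : set (clopen_algebra G) -> \bar R).
  by apply/(additive2P L0) => A B cA cB AB; exact: L_add.
pose mC := isContent.Build _ (clopen_algebra G) R L L_ge0 Ladd.
pose L1 : {content set (clopen_algebra G) -> \bar R} := HB.pack L mC.
have Lsub : measurable_subset_sigma_subadditive L1.
  move=> A F mF mA AF.
  have cA : compact (A : set (config_space G)).
    apply: (@subclosed_compact _ _ setT) => //; last exact: config_compact.
    exact: (proj2 mA).
  move: (cA); rewrite compact_cover => /(_ _ setT F).
  case=> [i _|//|D _ AD]; first exact: (proj1 (mF i)).
  pose n := (\max_(i <- finmap.enum_fset D) i.+1)%N.
  apply: (@le_trans _ _ (\sum_(i < n) L1 (F i))%E).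
    apply: content_subadditive => // w /AD[i /= iD Fiw].
    rewrite -bigcup_mkord; exists i => //=.
    by apply: (@leq_bigmax_seq nat (finmap.enum_fset D) xpredT (fun i => i.+1)).
  rewrite -(big_mkord xpredT (fun i => L1 (F i))).
  by apply: nneseries_lim_ge => *; exact: L_ge0.
pose mM := Content_SigmaSubAdditive_isMeasure.Build _ _ _ L1 Lsub.
pose L2 : {measure set (clopen_algebra G) -> \bar R} := HB.pack L mC mM.
pose X := g_sigma_algebraType (@measurable _ (clopen_algebra G)).
have mid : measurable_fun setT (id : X -> config G).
  apply: (@measurability _ _ X (config G) setT id (@open (config_space G)));
    first by [].
  move=> _ [A oA <-]; rewrite setTI preimage_id.
  have [F [FE ->]] := open_cylinders countable_edges oA.
  apply: bigcupT_measurable => n; apply: sub_sigma_algebra.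
  have [->|[s ->]] := FE n; [exact: clopen0|exact: cylinder_clopen].
have [mu muE] := pushforward_exists (measure_extension L2) mid.
exists mu => A cA; rewrite muE preimage_id /=.
by rewrite /measure_extension measurable_mu_extE.
Qed.
End extension.

(** * Weak limits of measures on configurations *)

Lemma ultra_bounded_cvg (R : realType) (T : Type) (U : set_system T)
    (UU : UltraFilter U) (h : T -> \bar R) (M : R) :
  (forall t, (0 <= h t <= M%:E)%E) ->
  exists2 x : R, 0 <= x & h @ U --> x%:E.
Proof.
move=> hM.
have hfin t : h t \is a fin_num.
  have /andP[h0 hM'] := hM t.
  by rewrite ge0_fin_numE// (le_lt_trans hM')// ltry.
have PF : ProperFilter (fine \o h @ U) by exact: fmap_proper_filter.
have [|x [/= x0M xcl]] := @segment_compact R 0 M (fine \o h @ U) PF.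
  apply: nearW => t /=; rewrite in_itv/= -!lee_fin fineK//.
exists x; first by move: x0M; rewrite in_itv/= => /andP[].
apply: cvg_EFin; first exact: nearW.
(* A cluster point of the image of an ultrafilter is a limit: a neighbourhood
   whose preimage is not in U has a complement that meets it. *)
move=> B Bx; have [//|UB] := in_ultra_setVsetC ((fine \o h) @^-1` B) UU.
by have [y []] := xcl (~` B) B UB Bx.
Qed.

Section compactness.
Variables (R : realType) (G : graph) (T : Type) (U : set_system T).
Variables (UU : UltraFilter U) (m : T -> {measure set (config G) -> \bar R}).
Hypothesis countable_edges : countable [set: edge G].

(** Weak compactness.  Limits along an ultrafilter exist for all clopen sets
    at once and inherit finite additivity. *)
Lemma config_measure_compact (M : R) : (forall t, (m t setT <= M%:E)%E) ->
  exists mu : {measure set (config G) -> \bar R},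
    forall A : set (config_space G), clopen A -> m t A @[t --> U] --> mu A.
Proof.
move=> mM.
have /choice[L L_lim] : forall A : set (config_space G), exists l : R,
    0 <= l /\ (clopen A -> m t A @[t --> U] --> l%:E).
  move=> A; have [cA|nA] := pselect (clopen A); last first.
    by exists 0; split.
  have [|x x0 mx] := @ultra_bounded_cvg R T U UU (fun t => m t A) M.
    move=> t; rewrite measure_ge0/= (le_trans _ (mM t))// le_measure ?inE//.
    exact: clopen_measurable.
  by exists x.
have Lu A l : clopen A -> m t A @[t --> U] --> l -> (L A)%:E = l.
  by move=> cA; apply: cvg_unique => //; exact: (L_lim A).2.
have L0 : (L set0)%:E = 0%E.
  apply: Lu; first exact: clopen0.
  by under eq_fun do rewrite measure0; exact: cvg_cst.
have LD A B : clopen A -> clopen B -> A `&` B = set0 ->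
    (L (A `|` B))%:E = ((L A)%:E + (L B)%:E)%E.
  move=> cA cB AB; apply: Lu; first exact: clopenU.
  rewrite (_ : (fun t => _) = (fun t => m t A) \+ (fun t => m t B))%E.
    by apply: cvgeD => //; [exact: (L_lim A).2|exact: (L_lim B).2].
  by apply/funext => t /=; rewrite measureU//; exact: clopen_measurable.
have L_ge0 A : (0 <= (L A)%:E)%E by rewrite lee_fin; exact: (L_lim A).1.
have [mu muE] := clopen_content_extends countable_edges L_ge0 L0 LD.
exists mu => A cA; rewrite muE//; exact: (L_lim A).2.
Qed.

Variable mu : {measure set (config G) -> \bar R}.
Hypothesis mu_lim :
  forall A : set (config_space G), clopen A -> m t A @[t --> U] --> mu A.

(** One half of the portmanteau theorem: an open set is an increasing union of
    clopen sets, on which the measures converge. *)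
Lemma open_limit_le (S : set (config_space G)) (b : \bar R) : open S ->
  (\forall t \near U, (m t S <= b)%E) -> (mu S <= b)%E.
Proof.
move=> oS mb.
have [F [FE SE]] := open_cylinders countable_edges oS.
have cF n : clopen (F n).
  by have [->|[s ->]] := FE n; [exact: clopen0|exact: cylinder_clopen].
pose A n := \big[setU/set0]_(i < n) F i.
have cA n : clopen (A n).
  apply: (big_ind (@clopen (config_space G))) => //; first exact: clopen0.
  exact: clopenU.
have AS n : A n `<=` S.
  by rewrite SE /A -bigcup_mkord => w [i _ ?]; exists i.
have : mu (A n) @[n --> \oo] --> mu S.
  have -> : S = \bigcup_n A n.
    rewrite SE; apply/seteqP; split=> w [n _ Fw].
      by exists n.+1 => //; rewrite /A big_ord_recr; right.
    by move: Fw; rewrite /A -bigcup_mkord => -[i _ ?]; exists i.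
  apply: nondecreasing_cvg_mu.
  - by move=> n; exact: clopen_measurable.
  - by apply: bigcupT_measurable => n; exact: clopen_measurable.
  - by move=> i j ij; apply/subsetPset; exact: subset_bigsetU.
apply: cvge_le; apply: nearW => n.
apply: cvge_le (mu_lim (cA n)); apply: filterS mb => t.
apply: le_trans; rewrite le_measure ?inE//; first exact: clopen_measurable.
exact: open_measurable_config.
Qed.
End compactness.

(** * Walks, clusters and countability *)

Section graph.
Variable G : graph.
Implicit Types (F : set (edge G)) (u v w : vertex G) (l : seq (edge G)).

(** Walks recorded by their edges, so that being open along a walk is an event
    that depends on finitely many edges even when there are multiple edges. *)
Fixpoint edge_walk u l v : Prop :=
  if l is e :: l' then exists2 w, ends e = [set u; w] & edge_walk w l' v
  else u = v.

Definition all_open l : set (config G) :=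
  [set x | forall e, e \in l -> open_edges x e].

Lemma walk_edges F u v n : walk F u v n <->
  exists l, [/\ edge_walk u l v, size l = n & forall e, e \in l -> F e].
Proof.
split=> [[s []]|[l []]].
  elim: s u n => [|w s IH] u n /=; first by move=> _ <- <-; exists [::].
  move=> /andP[/asboolP[e Fe ee] ws] sv <-.
  have [l [wl <- lF]] := IH w _ ws sv erefl.
  exists (e :: l); split => //; first by exists w.
  by move=> e'; rewrite in_cons => /orP[/eqP ->|/lF].
elim: l u n => [|e l IH] u n /=; first by move=> <- <- _; exists [::].
move=> [w ee wl] <- lF.
have [|s [ws sv <-]] := IH w (size l) wl erefl.
  by move=> e' e'l; apply: lF; rewrite in_cons e'l orbT.
exists (w :: s); split => //=; rewrite ws andbT; apply/asboolP; exists e => //.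
by apply: lF; rewrite mem_head.
Qed.

Lemma same_component_edges F u v : same_component F u v <->
  exists2 l, edge_walk u l v & forall e, e \in l -> F e.
Proof.
split=> [[n /walk_edges[l [ul _ lF]]]|[l ul lF]]; first by exists l.
by exists (size l); apply/walk_edges; exists l.
Qed.

Lemma edge_walk_cat u v w l l' :
  edge_walk u l v -> edge_walk v l' w -> edge_walk u (l ++ l') w.
Proof.
elim: l u => [u -> //|e l IH u [x ex xl] vl] /=; exists x => //; exact: IH.
Qed.

Lemma edge_walk_rev u v l : edge_walk u l v -> edge_walk v (rev l) u.
Proof.
elim: l u => [u -> //|e l IH u [x ex xl]] /=; rewrite rev_cons -cats1.
by apply: (edge_walk_cat (IH _ xl)); exists u; rewrite // setUC.
Qed.

Lemma same_component_refl F u : same_component F u u.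
Proof. by apply/same_component_edges; exists [::]. Qed.

Lemma same_component_sym F u v : same_component F u v -> same_component F v u.
Proof.
move=> /same_component_edges[l ul lF]; apply/same_component_edges.
by exists (rev l); [exact: edge_walk_rev|move=> e; rewrite mem_rev; exact: lF].
Qed.

Lemma same_component_trans F v u w :
  same_component F u v -> same_component F v w -> same_component F u w.
Proof.
move=> /same_component_edges[l ul lF] /same_component_edges[l' vl' l'F].
apply/same_component_edges; exists (l ++ l'); first exact: edge_walk_cat vl'.
by move=> e; rewrite mem_cat => /orP[/lF|/l'F].
Qed.

Lemma same_component_mono F F' u v : F `<=` F' ->
  same_component F u v -> same_component F' u v.
Proof.
move=> FF' /same_component_edges[l ul lF]; apply/same_component_edges.
by exists l => // e /lF /FF'.
Qed.

Lemma cluster_refl (x : config G) u : same_cluster u u x.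
Proof. exact: same_component_refl. Qed.

Lemma cluster_sym (x : config G) u v : same_cluster u v x -> same_cluster v u x.
Proof. exact: same_component_sym. Qed.

Lemma cluster_trans (x : config G) v u w :
  same_cluster u v x -> same_cluster v w x -> same_cluster u w x.
Proof. exact: same_component_trans. Qed.

Lemma same_clusterE u v :
  same_cluster u v = \bigcup_(l in [set l | edge_walk u l v]) all_open l.
Proof.
apply/seteqP; split=> x.
  by move=> /same_component_edges[l ul lx]; exists l.
by move=> [l ul lx]; apply/same_component_edges; exists l.
Qed.

Lemma all_open_sub_cluster u v l : edge_walk u l v ->
  all_open l `<=` same_cluster u v.
Proof. by move=> ul x xl; rewrite same_clusterE; exists l. Qed.

Lemma all_open_clopen l : clopen (all_open l : set (config_space G)).
Proof.
rewrite (_ : all_open l = cylinder [seq (e, true) | e <- l]).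
  exact: cylinder_clopen.
apply/seteqP; split=> x xl.
  by move=> _ /mapP[e el ->]; exact: xl.
by move=> e el; apply: (xl (e, true)); apply/mapP; exists e.
Qed.

Lemma same_cluster_open u v : open (same_cluster u v : set (config_space G)).
Proof.
rewrite same_clusterE; apply: bigcup_open => l _; exact: (all_open_clopen l).1.
Qed.

Lemma same_cluster_measurable u v : measurable (same_cluster u v).
Proof. by apply: open_measurable_config; exact: same_cluster_open. Qed.

Lemma all_open_measurable l : measurable (all_open l).
Proof. by apply: clopen_measurable; exact: all_open_clopen. Qed.

Lemma edge_openE e : edge_open e = all_open [:: e].
Proof.
apply/seteqP; split=> x; first by move=> xe e'; rewrite mem_seq1 => /eqP ->.
by apply; rewrite mem_head.
Qed.

Lemma edge_open_measurable (e : edge G) : measurable (edge_open e).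
Proof. by rewrite edge_openE; exact: all_open_measurable. Qed.

Hypothesis G_connected : connected_graph G.

Lemma gdistP u v : walk setT u v (gdist u v) /\
  forall m, walk setT u v m -> (gdist u v <= m)%N.
Proof.
rewrite /gdist; case: xgetP => [n -> //|].
have [n0 n0P] := G_connected u v.
have ex : exists n, `[< walk setT u v n >] by exists n0; apply/asboolP.
case: (ex_minnP ex) => n /asboolP nP nmin /(_ n) []; split => // m mP.
by apply: nmin; apply/asboolP.
Qed.

Lemma geodesic u v : exists2 l, edge_walk u l v & size l = gdist u v.
Proof. by have [/walk_edges[l [ul ln _]] _] := gdistP u v; exists l. Qed.

(** The distance is 0 for a loop. *)
Lemma gdist_edge e u v : ends e u -> ends e v -> (gdist u v <= 1)%N.
Proof.
have [a [b eab]] := ends_pair e.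
have [uv _ _|nuv] := pselect (u = v).
  apply: leq_trans (leq0n 1); apply: (gdistP u v).2; subst v.
  by exists [::].
move=> eu ev; apply: (gdistP u v).2; apply/walk_edges; exists [:: e].
split=> //=; exists v => //; rewrite eab.
move: eu ev; rewrite eab => -[] uE [] vE; move: nuv; rewrite uE vE //.
by rewrite setUC.
Qed.

Hypothesis G_locally_finite : locally_finite G.

Lemma ends_finite (e : edge G) : finite_set (ends e).
Proof. by have [a [b ->]] := ends_pair e; rewrite finite_setU; split. Qed.

Lemma sphere_finite u n :
  finite_set [set v | exists2 l, edge_walk u l v & size l = n].
Proof.
elim: n u => [|n IH] u.
  apply: (sub_finite_set (B := [set u])) => // v [[|//] /= -> //].
(* The first edge is one of the finitely many edges at u. *)
pose S := \bigcup_(e in [set e : edge G | ends e u])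
  \bigcup_(w in ends e) [set v | exists2 l, edge_walk w l v & size l = n].
apply: (sub_finite_set (B := S)).
  move=> v [[//|e l] [w ew wl] [ln]]; exists e; first by rewrite /= ew; left.
  by exists w; [rewrite ew; right|exists l].
apply: bigcup_finite => // e _; apply: bigcup_finite => //; exact: ends_finite.
Qed.

Lemma countable_vertices : countable [set: vertex G].
Proof.
have [[v0 _]|no] := pselect (exists v0 : vertex G, True); last first.
  by rewrite (_ : setT = set0)// -subset0 => v0 _; apply: no; exists v0.
rewrite (_ : setT =
    \bigcup_n [set v | exists2 l, edge_walk v0 l v & size l = n]).
  apply: bigcup_countable => // n _.
  exact/finite_set_countable/sphere_finite.
apply/seteqP; split=> // v _; have [l ol _] := geodesic v0 v.
by exists (size l) => //; exists l.
Qed.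

Lemma countable_edges : countable [set: edge G].
Proof.
rewrite (_ : setT = \bigcup_(v in setT) [set e : edge G | ends e v]).
  apply: bigcup_countable => [|v _]; first exact: countable_vertices.
  exact: finite_set_countable.
apply/seteqP; split=> // e _; have [a [b ab]] := ends_pair e.
by exists a => //=; rewrite ab; left.
Qed.

Lemma vertex_enumeration (v0 : vertex G) :
  exists vt : nat -> vertex G, forall v, exists n, vt n = v.
Proof.
have /pcard_leP/unsquash f := countable_vertices.
pose vt n := xget v0 [set v | f v = n].
exists vt => v; exists (f v); rewrite /vt.
case: xgetP => [w _ /= fwv|/(_ v)]; last by case.
by apply: (@inj _ _ _ f); rewrite ?inE.
Qed.

End graph.

(** * Cutting a configuration into labelled clusters *)

(** Its edge configurations are the subsets of V; in this way the results on
    configurations also apply to random subsets of V. *)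
Definition loops (V : choiceType) : graph :=
  @Graph V V (fun v => [set v; v])
    (fun v => ex_intro _ v (ex_intro _ v erefl)).

Section labels.
Variables (G : graph) (vt : nat -> vertex G).
Implicit Types (x : config G) (u v : vertex G) (k : nat).

(** The number k identifies the cluster of v: it is the least index of a vertex
    of that cluster in the enumeration vt.  The cluster of the root vt 0 is the
    one with label 0. *)
Definition label x v k : Prop :=
  same_cluster (vt k) v x /\ forall j, (j < k)%N -> ~ same_cluster (vt j) v x.

Lemma label_exists x v n : vt n = v -> exists2 k, (k <= n)%N & label x v k.
Proof.
move=> vtn.
pose Q (k : nat) := `[< same_cluster (vt k) v x >].
have Qn : Q n by apply/asboolP; rewrite vtn; exact: cluster_refl.
have ex : exists k, Q k by exists n.
case: (ex_minnP ex) => k /asboolP kP kmin; exists k; first exact: kmin.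
by split=> // j jk jv; have := kmin j; rewrite leqNgt jk => /(_ (asboolT jv)).
Qed.

Lemma label_uniq x v k k' : label x v k -> label x v k' -> k = k'.
Proof.
move=> [vk kmin] [vk' k'min].
by case: (ltngtP k k') => [/k'min|/kmin|].
Qed.

Lemma label_same x u v k : same_cluster u v x -> label x u k -> label x v k.
Proof.
move=> uv [uk kmin]; split; first exact: cluster_trans uv.
move=> j /kmin h jv; apply: h; apply: cluster_trans jv _.
exact: cluster_sym.
Qed.

Lemma same_label x u v k : label x u k -> label x v k -> same_cluster u v x.
Proof.
move=> [uk _] [vk _]; apply: cluster_trans vk.
exact: cluster_sym.
Qed.

Lemma label_measurable v k : measurable [set x | label x v k].
Proof.
rewrite (_ : mkset _ = same_cluster (vt k) v `&`
    \bigcap_(j in [set j | (j < k)%N]) ~` same_cluster (vt j) v).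
  apply: measurableI; first exact: same_cluster_measurable.
  apply: bigcap_measurableType => // j _.
  by apply: measurableC; exact: same_cluster_measurable.
by apply/seteqP; split=> x [h1 h2]; split=> // j; exact: h2.
Qed.

Definition label_class k x : config (loops (vertex G)) :=
  fun v => `[< label x v k >].

Definition separates u v : set (config (loops (vertex G))) :=
  [set y | y u != y v].

Lemma separates_clopen u v :
  clopen (separates u v : set (config_space (loops (vertex G)))).
Proof.
rewrite (_ : separates u v =
    ([set y | y u = true] `&` [set y | y v = false])
    `|` ([set y | y u = false] `&` [set y | y v = true])).
  by apply: clopenU; apply: clopenI; exact: coord_clopen.
apply/seteqP; split=> y; rewrite /separates/=.
  by case: (y u) (y v) => -[] // _; [left|right].
by move=> [[-> ->]|[-> ->]].
Qed.

(** A nonempty class with label k contains vt k. *)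
Lemma label_class_sep_label u v k x :
  separates u v (label_class k x) -> label x (vt k) k.
Proof.
rewrite /separates/= /label_class.
case: asboolP => [[uk kmin] _|_].
  by apply: label_same (conj uk kmin); exact: cluster_sym.
case: asboolP => // -[vk kmin] _.
by apply: label_same (conj vk kmin); exact: cluster_sym.
Qed.

Lemma label_class_sep_lt u v k x i j : vt i = u -> vt j = v ->
  separates u v (label_class k x) -> (k <= maxn i j)%N.
Proof.
move=> iu jv; rewrite /separates/= /label_class leq_max.
case: asboolP => [uk _|_].
  have [k' k'i uk'] := label_exists x iu.
  by rewrite (label_uniq uk uk') k'i.
case: asboolP => // vk _.
have [k' k'j vk'] := label_exists x jv.
by rewrite (label_uniq vk vk') k'j orbT.
Qed.

Lemma label_not_root k x :
  label x (vt k.+1) k.+1 -> ~ same_cluster (vt 0) (vt k.+1) x.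
Proof. by move=> [_]; apply. Qed.

Lemma label_class_measurable k : countable [set: vertex G] ->
  measurable_fun setT (label_class k).
Proof.
move=> cV; apply: measurable_config_fun => // v.
rewrite (_ : mkset _ = [set x | label x v k]); first exact: label_measurable.
by apply/seteqP; split=> x; rewrite /=/label_class => /asboolP.
Qed.

Variables (R : realType) (P : percolation G R).
Local Open Scope ereal_scope.

(** When u and v are separated, exactly two clusters contain one of u and v but
    not both, and at most one of these two is the cluster of the root.  Their
    labels are at most N because the label of a vertex is at most its index. *)
Lemma separation_count u v N : (exists2 i, (i <= N)%N & vt i = u) ->
  (exists2 j, (j <= N)%N & vt j = v) ->
  let s := \sum_(k < N) P (label_class k.+1 @^-1` separates u v) in
  P (~` same_cluster u v) <= s /\ s <= 2%:E * P (~` same_cluster u v).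
Proof.
move=> [i iN iu] [j jN jv].
pose A w w' k := [set x | label x w k.+1] `&` ~` [set x | label x w' k.+1].
have mA w w' k : measurable (A w w' k).
  by apply: measurableI; [|apply: measurableC]; exact: label_measurable.
have sepE k : label_class k.+1 @^-1` separates u v = A u v k `|` A v u k.
  apply/seteqP; split=> x; rewrite /A /separates /label_class/=.
    by case: asboolP => ?; case: asboolP => ? // _; [left|right].
  by move=> [] [/asboolP -> /asboolPn/negbTE ->].
have mS := same_cluster_measurable u v.
split.
  apply: (@content_subadditive _ _ _ P _
    (fun k => label_class k.+1 @^-1` separates u v)).
  - by move=> k _; rewrite sepE; exact: measurableU.
  - exact: measurableC.
  - move=> x nuv.
    rewrite -(bigcup_mkord N (fun k => label_class k.+1 @^-1` separates u v)).
    have [k ki uk] := label_exists x iu; have [l lj vl] := label_exists x jv.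
    case: k ki uk => [|k] ki uk; last first.
      exists k; first exact: (leq_trans ki iN).
      rewrite sepE; left; split => // vk; apply: nuv; exact: same_label vk.
    case: l lj vl => [|l] lj vl; first by case: nuv; exact: same_label vl.
    exists l; first exact: (leq_trans lj jN).
    rewrite sepE; right; split => // ul; apply: nuv; exact: same_label vl.
have half w w' : ~` same_cluster w w' = ~` same_cluster u v ->
    \sum_(k < N) P (A w w' k) <= P (~` same_cluster u v).
  move=> ww'; rewrite -measure_bigsetU//.
    apply: le_measure; rewrite ?inE; first exact: bigsetU_measurable.
      exact: measurableC.
    rewrite -(bigcup_mkord N (A w w')) -ww' => x [k _ [wk w'k]] h.
    by apply: w'k; exact: label_same wk.
  by move=> k k' _ _ [x [[/= wk _] [wk' _]]]; have [] := label_uniq wk wk'.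
under eq_bigr => k _ do rewrite sepE.
apply: (@le_trans _ _ (\sum_(k < N) (P (A u v k) + P (A v u k)))).
  by apply: lee_sum => k _; exact: measureU2.
rewrite big_split/= mule_natl mule2n; apply: leeD; apply: half => //.
apply/seteqP; split=> x h h'; apply: h; exact: cluster_sym.
Qed.

End labels.

(** * The limit of rescaled cluster laws *)

Section cluster_limit.
Variables (R : realType) (G : graph) (vt : nat -> vertex G).
Hypothesis vt_surj : forall v, exists n, vt n = v.
Hypothesis cV : countable [set: vertex G].
Variables (T : Type) (U : set_system T) (UU : UltraFilter U).
Variables (P : T -> percolation G R) (g : T -> R).
Variable B : vertex G -> vertex G -> R.
Hypothesis g_gt0 : forall t, 0 < g t.
Hypothesis P_le :
  forall t u v, (P t (~` same_cluster u v) <= (g t * B u v)%:E)%E.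
Local Notation cuts := (config (loops (vertex G))).
Local Open Scope ereal_scope.

(** The class with label k is empty when vt k is not the least vertex of its
    cluster.  Those configurations carry a mass that explodes as g tends to 0,
    and contribute nothing to cuts: they are removed. *)
Lemma scaled_label_class_law t k : exists m : {measure set cuts -> \bar R},
  forall A, m A =
    (g t)^-1%:E *
    P t (label_class vt k @^-1` A `&` [set x | label vt x (vt k) k]).
Proof.
have g0 : (0 <= (g t)^-1)%R by rewrite invr_ge0 ltW.
have mL := label_measurable vt (vt k) k.
have [m mE] := pushforward_exists (mscale (NngNum g0) (mrestr (P t) mL))
  (label_class_measurable vt k cV).
by exists m => A; rewrite mE.
Qed.

(** For each label k > 0 the restricted laws have mass at most B (vt 0) (vt k),
    since a class with label k separates vt k from the root; so they have a
    limit.  Only finitely many labels matter for a given pair of vertices, which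
    lets the limit be taken term by term in the sum over the labels. *)
Lemma cluster_limit :
  exists nu : {measure set cuts -> \bar R},
  (forall v, nu (edge_open (v : edge (loops (vertex G)))) < +oo) /\
  forall u v, nu (separates u v) <= (2 * B u v)%:E /\
    forall b : R,
      (\forall t \near U, (g t * b)%:E <= P t (~` same_cluster u v)) ->
      b%:E <= nu (separates u v).
Proof.
have /choice[m mE] : forall tk : T * nat,
  exists m : {measure set cuts -> \bar R},
  forall A, m A = (g tk.1)^-1%:E * P tk.1
    (label_class vt tk.2.+1 @^-1` A `&`
     [set x | label vt x (vt tk.2.+1) tk.2.+1]).
  by move=> [t k]; exact: scaled_label_class_law.
have mM t k : m (t, k) setT <= (B (vt 0) (vt k.+1))%:E.
  rewrite mE /= preimage_setT setTI lee_pdivrMl ?invr_gt0// -EFinM.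
  apply: le_trans (P_le t _ _); rewrite le_measure ?inE//.
  - exact: label_measurable.
  - by apply: measurableC; exact: same_cluster_measurable.
  - by move=> x; exact: label_not_root.
have /choice[mu mu_lim] : forall k, exists mu : {measure set cuts -> \bar R},
    forall A : set (config_space (loops (vertex G))), clopen A ->
      m (t, k) A @[t --> U] --> mu A.
  move=> k; exact: (@config_measure_compact R (loops (vertex G)) T U UU
    (fun t => m (t, k)) cV _ (mM^~ k)).
have muM k : mu k setT <= (B (vt 0) (vt k.+1))%:E.
  by apply: cvge_le (mu_lim k _ clopenT); apply: nearW => t; exact: mM.
pose nu : {measure set cuts -> \bar R} := mseries mu 0.
exists nu.
(* The index k stands for the label k.+1, so the sum starts after the root. *)
have nuE A N : measurable A -> (forall k, (N <= k)%N -> mu k A = 0) ->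
    nu A = \sum_(k < N) mu k A.
  move=> mA AN; rewrite /nu /= /mseries (nneseries_split _ N)//.
  rewrite add0n eseries0 ?adde0 ?big_mkord// => k Nk _; exact: AN.
have mu0 (A : set (config_space (loops (vertex G)))) k : clopen A ->
    (forall t, m (t, k) A = 0) -> mu k A = 0.
  move=> cA A0; apply: (cvg_unique _ (mu_lim k A cA)) => //.
  rewrite (_ : (fun t => _) = cst 0); [exact: cvg_cst|exact/funext].
split=> [v|u v].
  have [n vn] := vt_surj v.
  have cv := @coord_clopen (loops (vertex G)) v true.
  rewrite (nuE _ n).
  - apply: lte_sum_pinfty => k _; apply: le_lt_trans (ltry _).
    apply: le_trans (muM k); rewrite le_measure ?inE//.
    exact: clopen_measurable.
  - exact: clopen_measurable.
  - move=> k nk; apply: mu0 => // t.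
    rewrite mE (_ : _ `&` _ = set0) ?measure0 ?mule0//.
    rewrite -subset0 => x [] /=; rewrite /edge_open/open_edges/= /label_class.
    move=> /asboolP vk _.
    have [l ln vl] := label_exists x vn.
    by move: ln; rewrite -(label_uniq vk vl) ltnNge nk.
have [i iu] := vt_surj u; have [j jv] := vt_surj v.
pose N := maxn i j.
have cs := separates_clopen u v.
have msE t k : m (t, k) (separates u v) =
    (g t)^-1%:E * P t (label_class vt k.+1 @^-1` separates u v).
  rewrite mE; congr (_ * P t _)%E; apply/setIidl => x.
  exact: label_class_sep_label.
rewrite (nuE _ N); last 2 first.
- exact: clopen_measurable.
- move=> k Nk; apply: mu0 => // t.
  rewrite msE (_ : _ @^-1` _ = set0) ?measure0 ?mule0//.
  rewrite -subset0 => x /= /(label_class_sep_lt iu jv).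
  by rewrite ltnNge Nk.
have sum_lim : \sum_(k < N) m (t, nat_of_ord k) (separates u v) @[t --> U] -->
    \sum_(k < N) mu k (separates u v).
  apply: cvg_nnesum; first by move=> k _; apply: nearW => t; exact: measure_ge0.
  by move=> k _; exact: mu_lim.
have sumE t : \sum_(k < N) m (t, nat_of_ord k) (separates u v) =
    (g t)^-1%:E * \sum_(k < N) P t (label_class vt k.+1 @^-1` separates u v).
  rewrite ge0_sume_distrr; first by apply: eq_bigr => k _; rewrite msE.
  by move=> k _; exact: measure_ge0.
have count t := @separation_count G vt R (P t) u v N
  (ex_intro2 _ _ i (leq_maxl i j) iu) (ex_intro2 _ _ j (leq_maxr i j) jv).
split=> [|b bP].
  apply: cvge_le sum_lim; apply: nearW => t; rewrite sumE lee_pdivrMl// -EFinM.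
  apply: (le_trans (count t).2); rewrite mulrCA EFinM.
  by apply: lee_wpmul2l => //; exact: P_le.
apply: cvge_ge sum_lim; apply: filterS bP => t bt.
rewrite sumE -lee_pdivrMl ?invr_gt0// -EFinM invrK.
exact: le_trans (count t).1.
Qed.
End cluster_limit.

(** * Indicators as elements of L^1 *)

Section indicators.
Variables (R : realType) (d : measure_display) (Y : measurableType d).
Variable nu : {measure set Y -> \bar R}.

Lemma ae_class_measurable (q : {mfun_ nu, Y >-> measurableTypeR R}) :
  measurable_fun setT (q : Y -> R).
Proof. exact: (@measurable_funPT _ _ _ _ (repr q)). Qed.

Lemma L1_indicator (A : set Y) : measurable A -> (nu A < +oo)%E ->
  exists g : LspaceType1 nu, {ae nu, forall y, (g : Y -> R) y = \1_A y}.
Proof.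
move=> mA nuA.
have mf : measurable_fun setT (\1_A : Y -> measurableTypeR R).
  exact: measurable_indic.
pose f : {mfun Y >-> measurableTypeR R} :=
  HB.pack (\1_A : Y -> measurableTypeR R) (isMeasurableFun.Build _ _ _ _ _ mf).
pose q : {mfun_ nu, Y >-> measurableTypeR R} := (\pi f)%qT.
have qf : {ae nu, forall y, (q : Y -> R) y = \1_A y}.
  have : ae_eq_op nu (repr q) f by rewrite -eqmodE reprK.
  by move=> /asboolP; apply: filterS => y /(_ I).
have fin : finite_norm nu 1 (q : Y -> R).
  rewrite /finite_norm Lnorm1.
  rewrite (_ : (\int[nu]_x _)%E = (\int[nu]_x (\1_A x)%:E)%E).
    by rewrite integral_indic// setIT.
  apply: ae_eq_integral => //.
  - do 2 apply: measurableT_comp => //.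
    exact: ae_class_measurable.
  - apply: measurableT_comp => //; exact: measurable_indic.
  - apply: filterS qf => y /= -> _; rewrite ger0_norm//.
pose g : LspaceType1 nu :=
  HB.pack q (isFinLebesgue.Build _ _ _ _ _ (@lexx _ _ 1%E) q fin).
by exists g.
Qed.

Lemma L1_measurable (g : LspaceType1 nu) : measurable_fun setT (g : Y -> R).
Proof. exact: ae_class_measurable. Qed.

Lemma L1dist_integral (g h : LspaceType1 nu) :
  L1dist g h = (\int[nu]_y `|(g : Y -> R) y - (h : Y -> R) y|%:E)%E.
Proof. by rewrite /L1dist Lnorm1. Qed.

Lemma L1dist_indicator (g h : LspaceType1 nu) (A B D : set Y) :
  measurable D -> (forall y, (\1_D y : R) = `|\1_A y - \1_B y|) ->
  {ae nu, forall y, (g : Y -> R) y = \1_A y} ->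
  {ae nu, forall y, (h : Y -> R) y = \1_B y} -> L1dist g h = nu D.
Proof.
move=> mD DE gA hB; rewrite L1dist_integral -(setIT D) -integral_indic//.
apply: ae_eq_integral => //.
- apply: measurableT_comp => //; apply: measurableT_comp => //.
  by apply: measurable_funB; exact: L1_measurable.
- apply: measurableT_comp => //; exact: measurable_indic.
- by apply: filterS2 gA hB => y /= -> -> _; rewrite DE.
Qed.
End indicators.

(** * From percolations to an L^1 map *)

Lemma all_open_union_bound (R : realType) (G : graph)
    (m : {measure set (config G) -> \bar R}) (q : R) (l : seq (edge G)) :
  (forall e, e \in l -> (m (~` edge_open e) <= q%:E)%E) ->
  (m (~` all_open l) <= ((size l)%:R * q)%:E)%E.
Proof.
elim: l => [|e l IH] lq.
  rewrite (_ : ~` _ = set0) ?measure0 ?mul0r// -subset0 => x; apply.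
  by move=> e; rewrite in_nil.
have cA e' l' : measurable (all_open (e' :: l')).
  exact: all_open_measurable.
have -> : all_open (e :: l) = edge_open e `&` all_open l.
  apply/seteqP; split=> x.
    move=> xl; split=> [|e' e'l]; apply: xl; rewrite in_cons ?eqxx//.
    by rewrite e'l orbT.
  by move=> [xe xl] e'; rewrite in_cons => /orP[/eqP ->|/xl].
rewrite setCI; apply: le_trans (measureU2 _ _ _) _.
- by apply: measurableC; exact: edge_open_measurable.
- by apply: measurableC; exact: all_open_measurable.
- rewrite /= -natr1 mulrDl mul1r EFinD [leRHS]addeC; apply: leeD.
    by apply: lq; rewrite mem_head.
  by apply: IH => e' e'l; apply: lq; rewrite in_cons e'l orbT.
Qed.

Section percolation_to_L1.
Variables (R : realType) (G : graph) (rho : \bar R -> \bar R).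
Hypothesis G_locally_finite : locally_finite G.
Hypothesis G_connected : connected_graph G.
Hypothesis rho_ge0 : forall x : \bar R, (0 <= x)%E -> (0 <= rho x)%E.

Let cV := countable_vertices G_connected G_locally_finite.

(** A union bound along a geodesic. *)
Lemma cluster_near_one (P : percolation G R) (n : nat) (u v : vertex G) :
  (forall e, ((1 - n.+1%:R^-1)%:E < P (edge_open e))%E) ->
  ((1 - (gdist u v)%:R / n.+1%:R)%:E <= P (same_cluster u v))%E.
Proof.
move=> Pe; have [l ul <-] := geodesic G_connected u v.
have mA : measurable (all_open l).
  exact: all_open_measurable.
apply: (@le_trans _ _ (P (all_open l))); last first.
  rewrite le_measure ?inE//; first exact: same_cluster_measurable.
  exact: all_open_sub_cluster.
have : (P (~` all_open l) <= ((size l)%:R * n.+1%:R^-1)%:E)%E.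
  apply: all_open_union_bound => e _.
  have mE : measurable (edge_open e).
    exact: edge_open_measurable.
  rewrite [leLHS](probability_setC P mE).
  have := Pe e; rewrite -(fineK (fin_num_measure P _ mE)) -EFinB.
  rewrite lte_fin lee_fin.
  by move/ltW; rewrite lerBlDr -lerBlDl.
rewrite probability_setC// -(fineK (fin_num_measure P _ mA)) -EFinB !lee_fin.
by rewrite lerBlDr -lerBlDl.
Qed.

(** The lower bound on the connection probability forces rho to be finite at
    distances between vertices, because exp (- oo) = 0. *)
Lemma percolation_bounds_at (C : R) (P : percolation G R) (beta gamma : R)
    (u v : vertex G) : 0 < gamma -> beta / gamma <= C ->
  (expeR (- (beta * (gdist u v)%:R)%:E) <= P (same_cluster u v))%E ->
  (P (same_cluster u v) <= expeR (- (gamma%:E * rho (gdist u v)%:R%:E)))%E ->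
  (P (~` same_cluster u v) <= (gamma * (C * (gdist u v)%:R))%:E)%E /\
  exists r, [/\ rho (gdist u v)%:R%:E = r%:E, 0 <= r &
    ((1 - expR (- (gamma * r)))%:E <= P (~` same_cluster u v))%E /\
    (P (same_cluster u v) <= (expR (- (gamma * r)))%:E)%E].
Proof.
move=> g0 bgC lb ub; have mS := same_cluster_measurable u v.
rewrite probability_setC//.
have [x xE] : exists x, P (same_cluster u v) = x%:E.
  by exists (fine (P (same_cluster u v))); rewrite fineK// fin_num_measure.
move: lb ub; rewrite xE => lb ub.
have {}lb : expR (- (beta * (gdist u v)%:R)) <= x by rewrite -lee_fin.
split.
  rewrite -EFinB lee_fin.
  have := expR_ge1Dx (- (beta * (gdist u v)%:R)).
  have : beta * (gdist u v)%:R <= gamma * (C * (gdist u v)%:R).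
    by rewrite mulrA ler_wpM2r// mulrC -ler_pdivrMr.
  by lra.
have r0 : (0 <= rho (gdist u v)%:R%:E)%E by apply: rho_ge0; rewrite lee_fin.
case: (rho (gdist u v)%:R%:E) r0 ub => [r||] //= r0 ub; last first.
  move: ub; rewrite gt0_muley ?lte_fin//= lee_fin leNgt => /negP[].
  exact: lt_le_trans (expR_gt0 _) lb.
exists r; rewrite -lee_fin; split => //; rewrite -EFinB !lee_fin.
have {}ub : x <= expR (- (gamma * r)) by rewrite -lee_fin.
by split => //; lra.
Qed.

Lemma percolation_to_L1 : percolation_bounds G rho -> L1_lower_bound G rho.
Proof.
move=> [C C0 perc].
have [[v0 _]|nov] := pselect (exists v0 : vertex G, True); last first.
  exists _, (config G), (mzero : {measure set (config G) -> \bar R}).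
  exists (fun v => False_rect _ (nov (ex_intro _ v I))), 1; split => //.
  by exists 1 => u; exfalso; apply: nov; exists u.
have [vt vt_surj] := vertex_enumeration G_connected G_locally_finite v0.
have /choice[X XP] : forall n : nat, exists X : percolation G R * R,
  [/\ forall e, ((1 - n.+1%:R^-1)%:E < X.1 (edge_open e))%E,
     0 < X.2 & forall u v : vertex G,
  (X.1 (~` same_cluster u v) <= (X.2 * (C * (gdist u v)%:R))%:E)%E /\
  exists r, [/\ rho (gdist u v)%:R%:E = r%:E, 0 <= r &
    ((1 - expR (- (X.2 * r)))%:E <= X.1 (~` same_cluster u v))%E /\
    (X.1 (same_cluster u v) <= (expR (- (X.2 * r)))%:E)%E]].
  move=> n; have [|P [Pe [b [g [b0 g0 bg Puv]]]]] := perc (1 - n.+1%:R^-1).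
    by rewrite ltrBlDr ltrDl invr_gt0.
  exists (P, g); split => // u v.
  by have [lb ub] := Puv u v; exact: percolation_bounds_at bg lb ub.
pose P n := (X n).1; pose gamma n := (X n).2.
have Pe n : forall e, ((1 - n.+1%:R^-1)%:E < P n (edge_open e))%E.
  by have [] := XP n.
have g0 n : 0 < gamma n by have [] := XP n.
have Puv n u v :
  (P n (~` same_cluster u v) <= (gamma n * (C * (gdist u v)%:R))%:E)%E /\
  exists r, [/\ rho (gdist u v)%:R%:E = r%:E, 0 <= r &
    ((1 - expR (- (gamma n * r)))%:E <= P n (~` same_cluster u v))%E /\
    (P n (same_cluster u v) <= (expR (- (gamma n * r)))%:E)%E].
  by have [_ _] := XP n; apply.
clearbody P gamma; clear X XP.
have P_le n u v := (Puv n u v).1.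
have [U [UU oU]] := ultraFilterLemma (@eventually_filter).
have [nu [nu_fin nuP]] :=
  cluster_limit vt_surj cV UU g0 P_le.
have /choice[f fP] : forall v : vertex G, exists g : LspaceType1 nu,
    {ae nu, forall y, (g : _ -> R) y =
      \1_(edge_open (v : edge (loops (vertex G)))) y}.
  move=> v; apply: L1_indicator; last exact: nu_fin.
  exact: edge_open_measurable.
have fE u v : L1dist (f u) (f v) = nu (separates u v).
  apply: (L1dist_indicator _ _ (fP u) (fP v)).
    by apply: clopen_measurable; exact: separates_clopen.
  move=> y; have yE w : (y \in edge_open (w : edge (loops (vertex G)))) = y w.
    by apply/idP/idP; rewrite inE.
  have -> : \1_(separates u v) y = (y u != y v)%:R :> R.
    rewrite indicE; congr (_%:R); congr nat_of_bool.
    by apply/idP/idP; rewrite inE.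
  rewrite !indicE !yE; case: (y u); case: (y v) => /=;
  by rewrite ?subrr ?subr0 ?sub0r ?normrN ?normr1 ?normr0.
exists _, _, nu, f, (1 / 2); split => //.
  by exists (2 * C) => u v; rewrite fE -mulrA; exact: (nuP u v).1.
move=> u v; rewrite fE.
have [_ [r [rE r0 _]]] := Puv 0%N u v.
rewrite rE -EFinM; apply: (nuP u v).2.
have : \forall n \near \oo, ((2 * gdist u v)%N <= n)%N by exact: nbhs_infty_ge.
move=> /oU; apply: filterS => n dn.
have [_ [r' [+ _ [lb ub]]]] := Puv n u v.
rewrite rE => -[rr']; rewrite -{}rr' in lb ub.
apply: le_trans lb; rewrite lee_fin.
have := le_trans (cluster_near_one u v (Pe n)) ub; rewrite lee_fin => near1.
(* For n >= 2 d(u,v) the connection probability is at least 1/2. *)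
have half : (gdist u v)%:R / n.+1%:R <= 1 / 2 :> R.
  rewrite ler_pdivrMr// mul1r mulrC ler_pdivlMr// -natrM ler_nat mulnC.
  exact: leqW.
have x0 : 0 <= gamma n * r by rewrite mulr_ge0// ltW.
have x1 : gamma n * r <= 1.
  apply: expRN_dichotomy; apply: le_trans near1.
  by move: half; move: (_ / _) => a; lra.
have := expRN_le_half x0 x1; lra.
Qed.
End percolation_to_L1.

(** * Intersections of independent percolations *)

Section mass_one.
Context d (T : measurableType d) (R : realType) (m : {measure set T -> \bar R}).
Hypothesis m1 : m setT = 1%E.

Let m' : set T -> \bar R := m.
HB.instance Definition _ := Measure.on m'.
HB.instance Definition _ := Measure_isProbability.Build _ _ _ m' m1.

Lemma probability_of_measure : exists P : probability T R, forall A, P A = m A.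
Proof. by exists m'. Qed.

End mass_one.

Section percolation_operations.
Variables (R : realType) (G : graph).
Hypothesis cE : countable [set: edge G].
Implicit Types (P Q S : percolation G R) (l : seq (edge G)) (u v : vertex G).
Local Open Scope ereal_scope.

Definition full_config : config G := fun=> true.

(** The missing mass is put on the configuration with all edges open. *)
Lemma subprobability_completion (m : {measure set (config G) -> \bar R}) :
  m setT <= 1 ->
  exists P, forall A, measurable A -> ~ A full_config -> P A = m A.
Proof.
move=> m1; have mfin : m setT \is a fin_num.
  by rewrite ge0_fin_numE// (le_lt_trans m1)// ltry.
have c0 : (0 <= 1 - fine (m setT))%R by rewrite subr_ge0 -lee_fin fineK.
pose m1' : {measure set (config G) -> \bar R} :=
  measure_add m (mscale (NngNum c0) (dirac full_config)).
have m1E A : m1' A = m A + (1 - fine (m setT))%:E * (full_config \in A)%:R%:E.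
  exact: (measure_addE m (mscale (NngNum c0) (dirac full_config))).
have [|P PE] := probability_of_measure (m := m1').
  by rewrite m1E in_setT mule1 -(fineK mfin) -EFinD addrC subrK.
exists P => A mA nA; rewrite PE m1E memNset// mule0 adde0 //.
Qed.

Definition meet_config (x : config G * config G) : config G :=
  fun e => x.1 e && x.2 e.

Lemma meet_config_measurable : measurable_fun setT meet_config.
Proof.
apply: measurable_config_fun => // e.
have me : measurable (edge_open e).
  exact: edge_open_measurable.
rewrite (_ : mkset _ = edge_open e `*` edge_open e); first exact: measurableX.
by apply/seteqP; split=> x; rewrite /= /meet_config => /andP.
Qed.

(** Take two independent configurations and keep the edges open in both.  The
    meet is open along a walk exactly when both configurations are; a connection
    in the meet is a connection in both, but not conversely. *)
Lemma percolation_meet P Q : exists S,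
  (forall l, S (all_open l) = P (all_open l) * Q (all_open l)) /\
  (forall u v,
    S (same_cluster u v) <= P (same_cluster u v) * Q (same_cluster u v)).
Proof.
have [m mE] := pushforward_exists (P \x Q) meet_config_measurable.
have [|S SE] := probability_of_measure (m := m).
  rewrite mE preimage_setT -setXTT [LHS]product_measure1E//.
  rewrite [X in X * _](probability_setT P) [X in _ * X](probability_setT Q).
  by rewrite mule1.
exists S; split=> [l|u v]; rewrite SE mE.
  have ml : measurable (all_open l).
    exact: all_open_measurable.
  rewrite -[RHS]product_measure1E//; congr (_ _).
  apply/seteqP; split=> x.
    by move=> xl; split=> e /xl /= /andP[].
  by move=> [xl xl'] e el; apply/andP; split; [exact: xl|exact: xl'].
have mS := same_cluster_measurable u v.
rewrite -[leRHS]product_measure1E//; apply: le_measure; rewrite ?inE.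
- by rewrite -[X in measurable X]setTI; exact: meet_config_measurable.
- exact: measurableX.
- move=> x xuv; split; apply: same_component_mono xuv => e;
  by rewrite /open_edges/= => /andP[].
Qed.

Lemma percolation_power P N : exists S,
  (forall l, S (all_open l) = P (all_open l) ^+ N) /\
  (forall u v, S (same_cluster u v) <= P (same_cluster u v) ^+ N).
Proof.
elim: N => [|N [S [Sl Suv]]].
  have SE A : (dirac full_config : percolation G R) A =
    (full_config \in A)%:R%:E by [].
  exists (dirac full_config); split=> [l|u v]; rewrite SE expe0.
    by rewrite mem_set.
  by case: (_ \in _); rewrite lee_fin.
have [S' [S'l S'uv]] := percolation_meet P S.
exists S'; split=> [l|u v]; rewrite expeS.
  by rewrite S'l Sl.
apply: le_trans (S'uv u v) _; apply: lee_wpmul2l => //; exact: Suv.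
Qed.

End percolation_operations.

(** * Walls of an L^1 map *)

Section walls.
Variables (R : realType) (d : measure_display) (Y : measurableType d).
Variables (nu : {measure set Y -> \bar R}) (V : Type) (f : V -> LspaceType1 nu).
Implicit Types u v w : V.

Definition below u (z : Y * measurableTypeR R) : bool :=
  z.2 < (f u : Y -> R) z.1.

Definition wall u v : set (Y * measurableTypeR R) :=
  [set z | below u z != below v z].

Lemma below_measurable u : measurable [set z | below u z].
Proof.
have mb : measurable_fun setT (below u).
  apply: (@measurable_fun_ltr _ _ R setT (fun z : Y * measurableTypeR R => z.2)
    (fun z => (f u : Y -> R) z.1)).
    exact: measurable_snd.
  by apply: measurableT_comp => //; exact: L1_measurable.
rewrite (_ : mkset _ = setT `&` below u @^-1` [set true]); first exact: mb.
by rewrite setTI; apply/seteqP; split=> z; rewrite /= => ->.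
Qed.

Lemma wall_measurable u v : measurable (wall u v).
Proof.
rewrite (_ : wall u v = ([set z | below u z] `&` ~` [set z | below v z])
   `|` ([set z | below v z] `&` ~` [set z | below u z])).
  have mu := below_measurable u; have mv := below_measurable v.
  by apply: measurableU; apply: measurableI => //; exact: measurableC.
apply/seteqP; split=> z; rewrite /wall/=.
  by case: (below u z) (below v z) => -[] // _; [left|right]; split.
by case: (below u z) (below v z) => -[]// [[]|[]].
Qed.

Lemma wall_triangle w u v : wall u v `<=` wall w u `|` wall w v.
Proof.
move=> z; rewrite /wall/=.
by case: (below u z) (below v z) (below w z) => -[] -[] // _; (left + right).
Qed.

(** The product integrates the Lebesgue measure of the sections, which makes
    sense for every measure nu. *)
Definition wall_measure : {measure set (Y * measurableTypeR R) -> \bar R} :=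
  (nu \x (@lebesgue_measure R))%E.

Lemma wall_measureE u v : wall_measure (wall u v) = L1dist (f u) (f v).
Proof.
rewrite L1dist_integral; apply: eq_integral => y _ /=.
set a := (f u : Y -> R) y; set b := (f v : Y -> R) y.
have itv (s t : R) : s <= t ->
    lebesgue_measure (`[s, t[%classic : set (measurableTypeR R)) = `|s - t|%:E.
  move=> st.
  rewrite lebesgue_measure_itv/= lte_fin distrC ger0_norm ?subr_ge0//.
  case: ltP => // ts; have -> : s = t by apply/eqP; rewrite eq_le st.
  by rewrite subrr.
rewrite (_ : xsection _ _ =
    if a <= b then `[a, b[%classic else `[b, a[%classic).
  case: leP => ab; first exact: itv.
  by rewrite itv ?(ltW ab)// distrC.
have side (s t r : R) : s <= t -> ((r < s) != (r < t)) = (s <= r < t).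
  move=> st; case: (ltP r s) => rs; case: (ltP r t) => rt //=.
  by exfalso; lra.
apply/seteqP; split=> t; rewrite /xsection/= inE /wall /below/= -/a -/b;
case: (leP a b) => ab /=; rewrite in_itv/= -side ?(ltW ab)//;
by rewrite eq_sym.
Qed.

End walls.

(** * One random wall *)

Section wall_percolation.
Variables (R : realType) (d : measure_display) (Y : measurableType d).
Variables (nu : {measure set Y -> \bar R}) (G : graph).
Variable f : vertex G -> LspaceType1 nu.
Hypothesis G_connected : connected_graph G.
Hypothesis cE : countable [set: edge G].
Implicit Types (u v w : vertex G) (e : edge G) (l : seq (edge G)).

(** A loop is never cut: the condition ranges over pairs of ends. *)
Definition wall_config (z : Y * measurableTypeR R) : config G :=
  fun e => `[< forall u v, ends e u -> ends e v -> below f u z = below f v z >].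

Lemma closed_edge_wall e u v : ends e = [set u; v] ->
  wall_config @^-1` (~` edge_open e) = wall f u v.
Proof.
move=> euv; apply/seteqP; split=> z;
rewrite /edge_open /open_edges /wall_config /wall/=.
  move=> /negP/asboolPn h; apply/eqP => buv; apply: h => a b.
  by rewrite euv => -[] -> [] ->.
move=> /eqP h /asboolP/(_ u v) e_uv; apply: h.
by apply: e_uv; rewrite euv; [left|right].
Qed.

Lemma wall_config_measurable : measurable_fun setT wall_config.
Proof.
apply: measurable_config_fun => // e; have [u [v euv]] := ends_pair e.
rewrite (_ : mkset _ = ~` wall f u v).
  by apply: measurableC; exact: wall_measurable.
by rewrite -(closed_edge_wall euv) preimage_setC setCK.
Qed.

(** The side of the wall is constant along a walk of uncut edges. *)
Lemma wall_config_cluster u v :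
  wall f u v `<=` wall_config @^-1` (~` same_cluster u v).
Proof.
move=> z; rewrite /wall/= => /eqP h /same_component_edges[l ul lz]; apply: h.
elim: l u ul lz => [u -> //|e l IH u [w ew wl] lz].
rewrite -(IH w wl); last by move=> e' e'l; apply: lz; rewrite in_cons e'l orbT.
have /asboolP := lz e (mem_head e l).
by apply; rewrite ew; [left|right].
Qed.

Variables (vt : nat -> vertex G) (K : R).
Hypothesis f_edge : forall e u v, ends e u -> ends e v ->
  (L1dist (f u) (f v) <= K%:E)%E.
Hypothesis f_fin : forall u v, (L1dist (f u) (f v) < +oo)%E.

(** The walls that separate some of the first n vertices: a set of finite
    measure, by comparison with vt 0. *)
Definition walls_below n : set (Y * measurableTypeR R) :=
  \big[setU/set0]_(i < n) wall f (vt 0) (vt i).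

Lemma walls_below_measurable n : measurable (walls_below n).
Proof. by apply: bigsetU_measurable => i _; exact: wall_measurable. Qed.

Lemma walls_below_fin n : (wall_measure nu (walls_below n) < +oo)%E.
Proof.
apply: le_lt_trans
  (_ : _ <= \sum_(i < n) wall_measure nu (wall f (vt 0%N) (vt i)))%E _.
  apply: (@content_subadditive _ _ _ (wall_measure nu) _
    (fun i => wall f (vt 0) (vt i))) => //.
    by move=> i _; exact: wall_measurable.
  exact: walls_below_measurable.
by apply: lte_sum_pinfty => i _; rewrite wall_measureE.
Qed.

Lemma wall_sub_below n i j : (i < n)%N -> (j < n)%N ->
  wall f (vt i) (vt j) `<=` walls_below n.
Proof.
move=> ni nj z /(wall_triangle (vt 0)); rewrite /walls_below.
rewrite -(bigcup_mkord n (fun i => wall f (vt 0) (vt i))).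
by case=> zw; [exists i|exists j].
Qed.

(** With probability t times the mass of walls_below n, draw a wall from the
    normalized restriction; otherwise keep all edges. *)
Lemma one_wall n (t : R) :
  0 < t -> t * fine (wall_measure nu (walls_below n)) <= 1 ->
  exists P : percolation G R,
  (forall l, ((1 - (size l)%:R * (t * K))%:E <= P (all_open l))%E) /\
  (forall i j r, (i < n)%N -> (j < n)%N ->
    L1dist (f (vt i)) (f (vt j)) = r%:E ->
    (P (same_cluster (vt i) (vt j)) <= (1 - t * r)%:E)%E).
Proof.
move=> t0 tM.
have mZ := walls_below_measurable n.
have [m mE] := pushforward_exists
  (mscale (NngNum (ltW t0)) (mrestr (wall_measure nu) mZ))
  wall_config_measurable.
have {}mE A : m A =
    (t%:E * wall_measure nu ((wall_config @^-1` A) `&` walls_below n))%E.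
  by rewrite mE.
have [|P PE] := subprobability_completion (m := m).
  rewrite mE preimage_setT setTI -(fineK (x := wall_measure _ _)).
    by rewrite -EFinM lee_fin.
  by rewrite ge0_fin_numE// walls_below_fin.
exists P; split=> [l|i j r ni nj rE].
  have ml : measurable (all_open l).
    exact: all_open_measurable.
  have : (P (~` all_open l) <= ((size l)%:R * (t * K))%:E)%E.
    rewrite PE; [|exact: measurableC|by apply=> e _].
    apply: all_open_union_bound => e _; rewrite mE EFinM.
    apply: lee_wpmul2l; first by rewrite lee_fin ltW.
    have [u [v euv]] := ends_pair e; rewrite (closed_edge_wall euv).
    apply: le_trans (_ : wall_measure nu (wall f u v) <= _)%E; last first.
      rewrite wall_measureE.
      by apply: (f_edge (e := e)); rewrite euv; [left|right].
    apply: measureIl; [exact: wall_measurable|exact: mZ].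
  rewrite probability_setC// -(fineK (fin_num_measure P _ ml)) -EFinB !lee_fin.
  by rewrite lerBlDr -lerBlDl.
have mS := same_cluster_measurable (vt i) (vt j).
have : ((t * r)%:E <= P (~` same_cluster (vt i) (vt j)))%E.
  rewrite PE; [|exact: measurableC|]; last first.
    apply; have := G_connected (vt i) (vt j).
    by apply: same_component_mono => e _.
  rewrite mE EFinM -rE -wall_measureE.
  apply: lee_wpmul2l; first by rewrite lee_fin ltW.
  apply: le_measure; rewrite ?inE; first exact: wall_measurable.
    apply: measurableI => //; rewrite -[X in measurable X]setTI.
    by apply: wall_config_measurable => //; exact: measurableC.
  by move=> z zw; split; [exact: wall_config_cluster|exact: wall_sub_below zw].
rewrite probability_setC// -(fineK (fin_num_measure P _ mS)) -EFinB !lee_fin.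
by rewrite lerBrDr -lerBrDl.
Qed.

End wall_percolation.

(** * The Poisson process of walls *)

Section wall_process.
Variables (R : realType) (d : measure_display) (Y : measurableType d).
Variables (nu : {measure set Y -> \bar R}) (G : graph).
Variable f : vertex G -> LspaceType1 nu.
Hypothesis G_connected : connected_graph G.
Hypothesis cE : countable [set: edge G].
Variables (vt : nat -> vertex G) (K lam : R).
Hypothesis K_gt0 : 0 < K.
Hypothesis lam_gt0 : 0 < lam.
Hypothesis f_edge : forall e u v, ends e u -> ends e v ->
  (L1dist (f u) (f v) <= K%:E)%E.
Hypothesis f_fin : forall u v, (L1dist (f u) (f v) < +oo)%E.

(** N independent walls, each present with intensity lam / N, approximate the
    Poisson process of intensity lam. *)
Lemma poisson_stage n : exists Q : percolation G R,
  (forall l : seq (edge G), (size l <= n)%N ->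
    ((expR (- (2 * (lam * K * (size l)%:R))))%:E <= Q (all_open l))%E) /\
  (forall i j r, (i < n)%N -> (j < n)%N ->
    L1dist (f (vt i)) (f (vt j)) = r%:E ->
    (Q (same_cluster (vt i) (vt j)) <= (expR (- (lam * r)))%:E)%E).
Proof.
pose M := fine (wall_measure nu (walls_below f vt n)).
have M0 : 0 <= M by exact/fine_ge0/measure_ge0.
(* N must exceed both lam M, for the walls to form a subprobability, and twice
   the exponents lam K |l| with |l| <= n, for the lower bound on powers. *)
pose b := 2 * (lam * K * n%:R) + lam * M + 1.
have lK0 : 0 <= lam * K by rewrite mulr_ge0// ltW.
have lM0 : 0 <= lam * M by rewrite mulr_ge0// ltW.
have lKn0 : 0 <= lam * K * n%:R by rewrite mulr_ge0.
have b0 : 0 <= b by rewrite /b; lra.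
pose N := Num.bound b.
have bN : b < N%:R by have := archi_boundP b0.
have N0 : (0 < N)%N by rewrite -(ltr0n R); apply: le_lt_trans bN.
have N0' : 0 < N%:R :> R by rewrite ltr0n.
have [||P [Pl Puv]] := @one_wall R d Y nu G f G_connected cE vt K f_edge f_fin
    n (lam / N%:R).
- by rewrite divr_gt0.
- rewrite mulrAC ler_pdivrMr// mul1r; apply: le_trans (ltW bN).
  by rewrite /b -/M; lra.
have [Q [Ql Quv]] := percolation_power cE P N.
exists Q; split=> [l ln|i j r ni nj rE].
  rewrite Ql; set x := lam * K * (size l)%:R.
  have x0 : 0 <= x by rewrite mulr_ge0.
  have xn : x <= lam * K * n%:R by rewrite ler_wpM2l// ler_nat.
  have x1 : 2 * x <= N%:R by apply: le_trans (ltW bN); rewrite /b; lra.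
  have ml : measurable (all_open l).
    exact: all_open_measurable.
  have := Pl l; rewrite -(fineK (fin_num_measure P _ ml)) -EFin_expe !lee_fin.
  rewrite (_ : (size l)%:R * _ = x / N%:R); last by rewrite /x; ring.
  move=> px; apply: le_trans (exp_le_pow x0 N0 x1) _.
  rewrite lerXn2r ?nnegrE//; first by rewrite subr_ge0 ler_pdivrMr// mul1r; lra.
  by rewrite fine_ge0// measure_ge0.
apply: le_trans (Quv _ _) _.
have mS := same_cluster_measurable (vt i) (vt j).
have := Puv i j r ni nj rE.
rewrite -(fineK (fin_num_measure P _ mS)) -EFin_expe !lee_fin.
set p := fine _; have p0 : 0 <= p by rewrite /p fine_ge0// measure_ge0.
rewrite mulrAC => px.
have x0 : 0 <= 1 - lam * r / N%:R by exact: le_trans px.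
by apply: le_trans (pow_le_exp N0 x0); rewrite lerXn2r ?nnegrE.
Qed.

Hypothesis vt_surj : forall v, exists n, vt n = v.

Lemma wall_percolation_exists : exists P : percolation G R,
  (forall l : seq (edge G),
    ((expR (- (2 * (lam * K * (size l)%:R))))%:E <= P (all_open l))%E) /\
  (forall u v r, L1dist (f u) (f v) = r%:E ->
    (P (same_cluster u v) <= (expR (- (lam * r)))%:E)%E).
Proof.
have /choice[Q QP] := poisson_stage.
have [U [UU oU]] := ultraFilterLemma (@eventually_filter).
have [|mu mu_lim] := config_measure_compact (M := 1) (m := Q) UU cE.
  by move=> n; rewrite [leLHS](probability_setT (Q n)).
have muT : mu setT = 1%E.
  apply: (cvg_unique _ (mu_lim _ clopenT)) => //.
  rewrite (_ : (fun t => _) = cst 1%E); first exact: cvg_cst.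
  by apply/funext => n; exact: (probability_setT (Q n)).
have [P PE] := probability_of_measure muT.
exists P; split=> [l|u v r uv]; rewrite PE.
  apply: cvge_ge (mu_lim _ (all_open_clopen l)).
  have : \forall n \near \oo, (size l <= n)%N by exact: nbhs_infty_ge.
  by move=> /oU; apply: filterS => n ln; exact: (QP n).1.
have [i iu] := vt_surj u; have [j jv] := vt_surj v.
apply: (open_limit_le UU cE mu_lim); first exact: same_cluster_open.
have : \forall n \near \oo, ((maxn i j).+1 <= n)%N by exact: nbhs_infty_ge.
move=> /oU; apply: filterS => n; rewrite gtn_max => /andP[ni nj].
by rewrite -iu -jv; apply: (QP n).2 => //; rewrite iu jv.
Qed.
End wall_process.

(** * From an L^1 map to percolations *)

Section L1_to_percolation.
Variables (R : realType) (G : graph) (rho : \bar R -> \bar R).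
Hypothesis G_locally_finite : locally_finite G.
Hypothesis G_connected : connected_graph G.

Lemma L1_to_percolation : L1_lower_bound G rho -> percolation_bounds G rho.
Proof.
move=> [d [Y [nu [f [c [[K fK] c0 fc]]]]]].
(* The constant K may be nonpositive, for instance on a single vertex. *)
pose K' := Num.max K 1.
have K'0 : 0 < K' by rewrite lt_max ltr01 orbT.
have cE := countable_edges G_connected G_locally_finite.
have fK' u v : (L1dist (f u) (f v) <= (K' * (gdist u v)%:R)%:E)%E.
  by apply: le_trans (fK u v) _; rewrite lee_fin ler_wpM2r// le_max lexx.
have f_fin u v : (L1dist (f u) (f v) < +oo)%E.
  exact: le_lt_trans (fK' u v) (ltry _).
have f_edge e u v : ends e u -> ends e v -> (L1dist (f u) (f v) <= K'%:E)%E.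
  move=> eu ev; apply: le_trans (fK' u v) _; rewrite lee_fin -[leRHS]mulr1.
  by rewrite ler_wpM2l ?(ltW K'0)// lern1; exact: gdist_edge eu ev.
exists (2 * K' / c); first by rewrite divr_gt0// mulr_gt0.
move=> p p1.
have [[v0 _]|nov] := pselect (exists v0 : vertex G, True); last first.
  exists (dirac (@full_config G) : percolation G R); split.
    by move=> e; have [u _] := ends_pair e; exfalso; apply: nov; exists u.
  exists (2 * K' / c), 1; split => //; first by rewrite divr_gt0// mulr_gt0.
    by rewrite divr1.
  by move=> u; exfalso; apply: nov; exists u.
have [vt vt_surj] := vertex_enumeration G_connected G_locally_finite v0.
(* An intensity with exp (- 2 lam K') = q, with p < q < 1. *)
pose q := (1 + Num.max p 0) / 2.
have [q0 q1 pq] : [/\ 0 < q, q < 1 & p < q].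
  by rewrite /q; case: (leP p 0) => p0; split; lra.
pose lam := - ln q / (2 * K').
have lam0 : 0 < lam by rewrite divr_gt0 ?mulr_gt0// oppr_gt0 ln_lt0// q0 q1.
have lamK : 2 * (lam * K') = - ln q by rewrite /lam; field; rewrite gt_eqF.
clearbody lam.
have [P [Pl Puv]] :=
  wall_percolation_exists G_connected cE K'0 lam0 f_edge f_fin vt_surj.
exists P; split=> [e|].
  rewrite edge_openE; apply: lt_le_trans (Pl _).
  by rewrite /= mulr1 lamK opprK lnK ?posrE// lte_fin.
exists (2 * (lam * K')), (lam * c); split.
- by rewrite mulr_gt0// mulr_gt0.
- by rewrite mulr_gt0.
- rewrite le_eqVlt; apply/orP; left; apply/eqP; field.
  by rewrite !gt_eqF.
move=> u v; split.
  have [l ul <-] := geodesic G_connected u v.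
  apply: le_trans (_ : _ <= P (all_open l))%E _.
    by have := Pl l; rewrite -EFinN /= !mulrA.
  apply: le_measure; rewrite ?inE; last exact: all_open_sub_cluster.
    exact: all_open_measurable.
  exact: same_cluster_measurable.
have [r rE] : exists r, L1dist (f u) (f v) = r%:E.
  exists (fine (L1dist (f u) (f v))); rewrite fineK// ge0_fin_numE ?f_fin//.
  exact: Lnorm_ge0.
apply: le_trans (Puv u v r rE) _.
have := fc u v; rewrite rE EFinM -muleA => cr.
rewrite (_ : (expR _)%:E = expeR (- (lam * r)%:E)); last by rewrite -EFinN.
rewrite lee_expeR leeN2 EFinM; apply: lee_wpmul2l => //.
by rewrite lee_fin ltW.
Qed.
End L1_to_percolation.

Theorem theorem4p3 (R : realType) (G : graph) (rho : \bar R -> \bar R)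
    (G_locally_finite : locally_finite G) (G_connected : connected_graph G)
    (rho_ge0 : forall x : \bar R, (0 <= x)%E -> (0 <= rho x)%E)
    (rho_eq0 : forall x : \bar R, (0 <= x)%E -> (rho x = 0%E <-> x = 0%E)) :
  L1_lower_bound G rho <-> percolation_bounds G rho.
Proof.
split; [exact: L1_to_percolation|exact: percolation_to_L1].
Qed.
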